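(* Let $L$ be a nilpotent symplectic alternating algebra of dimension $2n\geq 8$ with an ascending chain of isotropic ideals $\{0\}=I_0<I_1<\cdots<I_n$ where $\dim I_j=j$ for $j=1,\ldots,n$. Suppose $L$ is of maximal class, i.e. of nilpotence class $2n-3$. Then $$I_2=Z_1(L),\ I_3=Z_2(L),\ \ldots,\ I_{n-1}=Z_{n-2}(L),$$ $$I_{n-1}^{\perp}=Z_{n-1}(L),\ I_{n-2}^{\perp}=Z_n(L),\ \ldots,\ I_2^{\perp}=Z_{2n-4}(L).$$ Furthermore $Z_0(L),Z_1(L),\ldots,Z_{2n-3}(L)$ are the unique ideals of $L$ of dimensions $0,2,3,\ldots,n-1,n+1,n+2,\ldots,2n-2,2n$, respectively.
   Context: A symplectic alternating algebra (SAA) over a field $\mathbb{F}$ is a finite-dimensional vector space $L$ over $\mathbb{F}$ with a non-degenerate alternating bilinear form $(\ ,\ )$ and a bilinear product $\cdot$ satisfying $u\cdot u=0$ for all $u$ and $(u\cdot v,w)=(v\cdot w,u)$ for all $u,v,w\in L$. No associativity or Jacobi identity is assumed. For subspaces $U,V$, $UV$ is the subspace spanned by all products $uv$, $u\in U$, $v\in V$. A subspace $I$ is an ideal if $IL\leq I$; it is isotropic if $(u,v)=0$ for all $u,v\in I$. $I^{\perp}$ is the orthogonal complement of $I$ with respect to $(\ ,\ )$. $L^1=L$, $L^{m+1}=L^mL$; $Z_0(L)=\{0\}$, $Z_{m+1}(L)=\{x\in L: xL\leq Z_m(L)\}$. $L$ is nilpotent if $L^{m+1}=\{0\}$ for some $m\ge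 0$, and the smallest such $m$ is its (nilpotence) class. The class of a nilpotent SAA of dimension $2n\geq 6$ is at most $2n-3$; $L$ is of maximal class if its class equals $2n-3$. *)

(* Defs.v *)
From HB Require Import structures.
From mathcomp Require Import all_boot all_order all_algebra.

Set Implicit Arguments.
Unset Strict Implicit.
Unset Printing Implicit Defensive.

Import GRing.Theory.
Local Open Scope ring_scope.

(* {skew_symmetric L} is only a bilinear form with (u, v) = - (v, u): a
   consequence of being alternating, and weaker in characteristic 2. It is the
   carrier so that the library's orthov and nondegenerate apply; saa_formvv
   then asserts alternation. *)
Record saa (F : fieldType) (L : vectType F) := Saa {
  saa_form : {skew_symmetric L};
  saa_mul : {bilinear L -> L -> L};
  saa_formvv : forall u, saa_form u u = 0;
  saa_form_nondeg : nondegenerate saa_form;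
  saa_mulvv : forall u, saa_mul u u = 0;
  saa_form_cyc : forall u v w,
    saa_form (saa_mul u v) w = saa_form (saa_mul v w) u
}.

Section SAA.

Variables (F : fieldType) (L : vectType F) (A : saa L).
Implicit Types (U V W : {vspace L}) (x y u v : L) (m n : nat).

Definition saa_prodv U V : {vspace L} :=
  <<[seq saa_mul A u v | u <- vbasis U, v <- vbasis V]>>%VS.

Lemma memv_saa_mul U V u v :
  u \in U -> v \in V -> saa_mul A u v \in saa_prodv U V.
Proof.
move=> /coord_vbasis-> /coord_vbasis->.
rewrite linear_sumlz; apply: rpred_sum => i _; rewrite linearZl_LR rpredZ //.
rewrite linear_sumr; apply: rpred_sum => j _; rewrite linearZr_LR rpredZ //.
by apply/memv_span/allpairs_f; rewrite mem_nth ?size_tuple.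
Qed.

Lemma saa_prodvP {U V W} :
  reflect (forall u v, u \in U -> v \in V -> saa_mul A u v \in W)
          (saa_prodv U V <= W)%VS.
Proof.
apply: (iffP idP) => [/subvP sUVW u v uU vV|sUVW].
  exact/sUVW/memv_saa_mul.
apply/span_subvP => _ /allpairsP[[u v] /= [uU vV ->]].
by apply: sUVW; apply: vbasis_mem.
Qed.

Definition saa_ideal U : bool := (saa_prodv U fullv <= U)%VS.

Definition saa_perp U : {vspace L} := orthov (saa_form A) U.

Definition isotropic U : Prop := {in U &, forall u v, saa_form A u v = 0}.

(* Indexed so that lower_central m = L^m for m >= 1; the value at 0 is
   irrelevant. *)
Definition lower_central m : {vspace L} :=
  iter m.-1 (fun U => saa_prodv U fullv) fullv.

(* The bigcap is {x | x y \in upper_central m for all y : L}, with y running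
   over a basis of L; see mem_upper_centralP. *)
Fixpoint upper_central m : {vspace L} :=
  if m is m'.+1 then
    (\bigcap_(y <- vbasis fullv)
       linfun (applyr (saa_mul A) y) @^-1: upper_central m')%VS
  else 0%VS.

Lemma mem_upper_centralP m x :
  reflect (forall y, saa_mul A x y \in upper_central m)
          (x \in upper_central m.+1).
Proof.
have mem_cap (s : seq L) : (x \in (\bigcap_(y <- s)
    linfun (applyr (saa_mul A) y) @^-1: upper_central m)%VS) =
    all (fun y => saa_mul A x y \in upper_central m) s.
  elim: s => [|y s IHs]; first by rewrite big_nil memvf.
  by rewrite big_cons memv_cap IHs -memv_preim lfunE.
rewrite /= mem_cap; apply: (iffP allP) => [xZ y|xZ y _ //].
rewrite (coord_vbasis (memvf y)) linear_sumr; apply: rpred_sum => i _.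
by rewrite linearZr_LR rpredZ // xZ // mem_nth ?size_tuple.
Qed.

Lemma mem_upper_central m x :
  (x \in upper_central m.+1) =
  (saa_prodv <[x]> fullv <= upper_central m)%VS.
Proof.
apply/mem_upper_centralP/saa_prodvP => [xZ _ y /vlineP[k ->] _|xZ y].
  by rewrite linearZl_LR rpredZ.
by apply: xZ; rewrite ?memv_line ?memvf.
Qed.

Definition saa_nilpotent : Prop := exists m, lower_central m.+1 = 0%VS.

Definition saa_class m : Prop :=
  lower_central m.+1 = 0%VS /\
  forall k, lower_central k.+1 = 0%VS -> (m <= k)%N.

Definition isotropic_chain n (I : nat -> {vspace L}) : Prop :=
  [/\ I 0%N = 0%VS,
      forall j, (j < n)%N -> (I j <= I j.+1)%VS /\ I j != I j.+1,
      forall j, (j <= n)%N -> saa_ideal (I j) /\ isotropic (I j) &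
      forall j, (1 <= j <= n)%N -> \dim (I j) = j].

Definition unique_ideal_of_dim d U : Prop :=
  [/\ saa_ideal U, \dim U = d &
      forall V, saa_ideal V -> \dim V = d -> V = U].

End SAA.

Definition maximal_class_dims n : seq nat :=
  0%N :: iota 2 (n - 2) ++ iota n.+1 (n - 2) ++ [:: (2 * n)%N].

(* The dimensions missing from the list are 1, n and 2n - 1. *)
Example maximal_class_dims5 :
  maximal_class_dims 5 = [:: 0; 2; 3; 4; 6; 7; 8; 10]%N.
Proof. by []. Qed.

(* Main.v *)
Require Import Defs.
From mathcomp Require Import all_boot all_order all_algebra.
From mathcomp Require Import zify.

Set Implicit Arguments.
Unset Strict Implicit.
Unset Printing Implicit Defensive.

Import GRing.Theory.

(** Write Z_m for the upper central series, L^m for the lower one, P for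
orthogonal complements and dim L = 2n. Three facts about a symplectic
alternating algebra carry the proof.

- Duality ([prodv_perp]): (uv, w) is an alternating trilinear form, so UL <= V
  implies (PV)L <= PU. Hence L^(m+1) <= P(Z_m), and complements of ideals are
  ideals.
- No one-dimensional image ([prodv_dim_le1]): if UL has dimension at most 1,
  then UL = 0. This makes the series jump by two at both ends: an ideal of
  dimension d >= 2 lies in Z_(d-1) when the algebra is nilpotent
  ([ideal_sub_upper_dim]), and Z_m never has codimension 1 for m >= 1
  ([upper_codim1_full]).
- The same jump in the middle ([prodv_perp_lagrangian_hyperplane]): in a
  nilpotent algebra, if U is an ideal of codimension at most 1 in a Lagrangian
  ideal, then (PU)L <= U.

In class 2n-3 the series is strictly increasing up to Z_(2n-3) = L, and
codimension 1 is excluded, so counting down from the top gives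
dim Z_m <= m+2 for m <= 2n-4 ([dim_upper_le]). The third fact for I_(n-1) in
I_n gives P(I_(n-1)) <= Z_(n-1), and the dimensions agree, so this is an
equality ([upper_middle]).

Below the middle, I_j <= Z_(j-1) leaves a gap of one in the dimensions. It is
closed at Z_(n-2), which has dimension n-1 or n ([dim_upper_middle]): in
dimension n it would be isotropic, because
I_(n-1) <= Z_(n-2) <= Z_(n-1) = P(I_(n-1)), hence Lagrangian, and then
L^(n-1) <= P(Z_(n-2)) = Z_(n-2) would force L^(2n-3) = 0. Counting down from
Z_(n-2) gives dim Z_m = m+1 for 1 <= m <= n-2, so I_j = Z_(j-1) for
2 <= j <= n-1. Above the middle, duality turns these equalities into
P(I_j) <= Z_(2n-2-j), where the dimensions agree again.

Uniqueness follows: an ideal of dimension j with 2 <= j <= n-1 lies in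
Z_(j-1), which has the same dimension; larger ideals are handled through their
orthogonal complements. *)

(** * Subspaces of codimension one *)

Section LineExtension.
Local Open Scope ring_scope.

Variables (F : fieldType) (L : vectType F).
Implicit Types U V : {vspace L}.

Lemma dim_le1_line V : (\dim V <= 1)%N -> exists b, V = <[b]>%VS.
Proof.
move=> V1; exists (vpick V); apply/esym/eqP.
rewrite eqEdim -memvE memv_pick dim_vline vpick0 -dimv_eq0.
by case: (\dim V) V1 => [|[]].
Qed.

Lemma add_line_of_codim1 U V :
  (U <= V)%VS -> (\dim V <= (\dim U).+1)%N -> exists b, V = (U + <[b]>)%VS.
Proof.
move=> sUV dV; have [|b Vb] := @dim_le1_line (V :\: U)%VS.
  by have := dimv_cap_compl V U; rewrite (capv_idPr sUV); lia.
by exists b; rewrite -Vb addvC addv_diff (addv_idPl sUV).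
Qed.

End LineExtension.

(** * The trilinear form and orthogonal complements *)

Section SAATheory.
Local Open Scope ring_scope.

Variables (F : fieldType) (L : vectType F) (A : saa L).
Implicit Types (U V W : {vspace L}) (x y u v : L) (m k : nat).

Local Notation form := (saa_form A).
Local Notation mul := (saa_mul A).
Local Notation perp := (saa_perp A).
Local Notation prod := (saa_prodv A).
Local Notation Z := (upper_central A).
Local Notation lower := (lower_central A).
Local Notation ideal := (saa_ideal A).

Lemma saa_mulN u v : mul u v = - mul v u.
Proof.
have /eqP := saa_mulvv A (u + v).
by rewrite linearDl !linearDr /= !saa_mulvv add0r addr0 addr_eq0 => /eqP.
Qed.

Lemma saa_formv0P u : (forall v, form u v = 0) -> u = 0.
Proof.
move=> u0; apply/eqP; rewrite -memv0 -(eqP (saa_form_nondeg A)).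
by apply/mem_orthovP => v _.
Qed.

Lemma saa_form_eq0C u v : form u v = 0 -> form v u = 0.
Proof. by move=> /eqP; rewrite herm_eq0C => /eqP. Qed.

Lemma saa_form_mul_swap u v w : form (mul u v) w = - form (mul u w) v.
Proof. by rewrite saa_form_cyc saa_form_cyc saa_mulN linearNl. Qed.

Lemma saa_prodvS U V W : (U <= V)%VS -> (prod U W <= prod V W)%VS.
Proof.
move=> /subvP sUV; apply/saa_prodvP => u w uU wW.
exact: memv_saa_mul (sUV _ uU) wW.
Qed.

Lemma saa_idealP U :
  reflect (forall u v, u \in U -> mul u v \in U) (ideal U).
Proof.
apply: (iffP (saa_prodvP _)) => [UI u v uU|UI u v uU _]; last exact: UI.
exact: UI uU (memvf v).
Qed.

Lemma perpS U V : (U <= V)%VS -> (perp V <= perp U)%VS.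
Proof. by move=> sUV; rewrite orthov_sym (subv_trans sUV) // orthov_sym. Qed.

(** Each vector of a basis of U cuts the dimension of W by at most one. *)
Lemma dim_cap_perp U W : (\dim W <= \dim (W :&: perp U) + \dim U)%N.
Proof.
rewrite -{1}(span_basis (vbasisP U)).
rewrite -[in X in (_ + X)%N](size_tuple (vbasis U)).
elim: (tval (vbasis U)) W => [|x s IHs] W.
  by rewrite span_nil /saa_perp orthov0 capvf addn0.
have ->: (W :&: perp <<x :: s>> = (W :&: orthov form <[x]>) :&: perp <<s>>)%VS.
  rewrite -capvA; congr (_ :&: _)%VS; apply/eqP; rewrite eqEsubv subv_cap.
  by rewrite span_cons -orthovD subvv /= orthovD capvSl capvSr.
have := leq_dim_orthov1 form x W.
by have := IHs (W :&: orthov form <[x]>)%VS; rewrite /=; lia.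
Qed.

Lemma dim_perp U : (\dim (perp U) + \dim U = \dim {: L})%N.
Proof.
apply/eqP; rewrite eqn_leq; apply/andP; split; last first.
  by have := dim_cap_perp U fullv; rewrite capfv.
(* A vector of U orthogonal to a complement of [perp U] is orthogonal to all
   of L, so U embeds in the dual of that complement. *)
have := dim_cap_perp (perp U)^C U; rewrite dimv_compl.
have ->: (U :&: perp (perp U)^C = 0)%VS.
  apply/eqP; rewrite -subv0; apply/subvP => u; rewrite memv_cap.
  case/andP=> uU uC; rewrite -(eqP (saa_form_nondeg A)).
  rewrite -(addv_complf (perp U)) memvE orthovD -[X in _ && X]memvE uC andbT.
  by rewrite orthov_sym perpS // -memvE.
by rewrite dimv0; have := dimvS (subvf (perp U)); lia.
Qed.

Lemma perpK U : perp (perp U) = U.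
Proof.
apply/esym/eqP; rewrite eqEdim orthov_sym subvv /=.
by have := dim_perp U; have := dim_perp (perp U); lia.
Qed.

(** For v orthogonal to V and u in U, (vy, u) = - (uy, v), and uy lies in V. *)
Lemma prodv_perp U V :
  (prod U fullv <= V)%VS -> (prod (perp V) fullv <= perp U)%VS.
Proof.
move=> /saa_prodvP UV; apply/saa_prodvP => v y /mem_orthovP vV _.
apply/mem_orthovP => u uU; rewrite saa_form_cyc saa_mulN linearNl /=.
by rewrite (saa_form_eq0C (vV _ (UV _ _ uU (memvf y)))) oppr0.
Qed.

Lemma perp_ideal U : ideal U -> ideal (perp U).
Proof. exact: prodv_perp. Qed.

(** For fixed x in U all products xw are multiples of a single xy <> 0. Then
(xy, w) = - (xw, y) is a multiple of (xy, y) = (yy, x) = 0, for every w, so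
xy = 0 by nondegeneracy. *)
Lemma prodv_dim_le1 U V :
  (prod U fullv <= V)%VS -> (\dim V <= 1)%N -> prod U fullv = 0%VS.
Proof.
move=> /saa_prodvP UV /dim_le1_line[b Vb]; apply/eqP; rewrite -subv0.
apply/saa_prodvP => x y xU _; rewrite memv0; apply/eqP.
have Vx w : mul x w \in <[b]>%VS by rewrite -Vb UV ?memvf.
have [k xy] := vlineP _ _ (Vx y); have [k0|k0] := eqVneq k 0.
  by rewrite xy k0 scale0r.
apply: saa_formv0P => w; rewrite saa_form_mul_swap.
have [l xw] := vlineP _ _ (Vx w).
have ->: mul x w = (l / k) *: mul x y by rewrite xw xy scalerA divfK.
by rewrite linearZl_LR /= saa_form_cyc saa_mulvv linear0l mulr0 oppr0.
Qed.

(** * Central series and duality *)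

Lemma sub_upper_centralS U m : (U <= Z m.+1)%VS = (prod U fullv <= Z m)%VS.
Proof.
apply/subvP/saa_prodvP => [UZ u y /UZ/mem_upper_centralP//|UZ u uU].
by apply/mem_upper_centralP => y; rewrite UZ ?memvf.
Qed.

Lemma upper_central_ideal m : ideal (Z m).
Proof.
elim: m => [|m IHm].
  by apply/saa_idealP => u v; rewrite memv0 => /eqP->; rewrite linear0l mem0v.
apply: (@subv_trans _ _ (Z m)); first by rewrite -sub_upper_centralS.
by rewrite sub_upper_centralS.
Qed.

Lemma upper_centralSS m : (Z m <= Z m.+1)%VS.
Proof. by rewrite sub_upper_centralS; apply: upper_central_ideal. Qed.

Lemma upper_central_mono m k : (m <= k)%N -> (Z m <= Z k)%VS.
Proof.
move=> /subnK<-; elim: (k - m)%N => [|i IHi]; first exact: subvv.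
exact: subv_trans IHi (upper_centralSS _).
Qed.

Lemma lower_centralSS m : lower m.+2 = prod (lower m.+1) fullv.
Proof. by []. Qed.

(** Both sides say that multiplying L on the right m + k times gives 0: moving
one multiplication from the left of the inclusion to the right of it is
[sub_upper_centralS]. *)
Lemma lower_sub_upper m k : (lower m.+1 <= Z k)%VS = (fullv <= Z (m + k))%VS.
Proof.
elim: m k => [|m IHm] k //.
by rewrite lower_centralSS -sub_upper_centralS IHm addnS.
Qed.

Lemma lower_eq0 m : (lower m.+1 == 0)%VS = (fullv <= Z m)%VS.
Proof. by rewrite -subv0 (lower_sub_upper m 0) addn0. Qed.

Lemma lower_sub_perp_upper m : (lower m.+1 <= perp (Z m))%VS.
Proof.
elim: m => [|m IHm]; first by rewrite /saa_perp orthov0.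
apply: subv_trans (saa_prodvS _ IHm) (prodv_perp _).
by rewrite -sub_upper_centralS.
Qed.

(** L^(m+2) = L^(m+1) L lies in the orthogonal complement of Z_(m+1), which
has dimension at most 1, so it vanishes by [prodv_dim_le1]. The index must be
positive for L^(m+2) to be a product. *)
Lemma upper_codim1_full m :
  (\dim {: L} <= (\dim (Z m.+1)).+1)%N -> (fullv <= Z m.+1)%VS.
Proof.
move=> dZ; rewrite -lower_eq0 lower_centralSS; apply/eqP.
apply: (prodv_dim_le1 (lower_sub_perp_upper m.+1)).
by have := dim_perp (Z m.+1); lia.
Qed.

(** * Ideals of a nilpotent algebra *)

Section Nilpotent.

Variable c : nat.
Hypothesis Zc : (fullv <= Z c)%VS.

(** If the trace of the upper central series on V stops growing at one step,
it never grows again; but it reaches V. *)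
Lemma ideal_sub_upper V m :
  ideal V -> (V :&: Z m.+1 <= Z m)%VS -> (V <= Z m)%VS.
Proof.
move=> /saa_idealP VI VZ.
have VZi i : (V :&: Z (i + m) <= Z m)%VS.
  elim: i => [|i IHi]; first exact: capvSr.
  apply: subv_trans VZ; rewrite subv_cap capvSl sub_upper_centralS /=.
  apply: subv_trans IHi; apply/saa_prodvP => v y.
  rewrite !memv_cap => /andP[vV /mem_upper_centralP vZ] _.
  by rewrite VI // vZ.
have:= VZi c; rewrite (capv_idPl _) //.
exact: subv_trans (subvf V) (subv_trans Zc (upper_central_mono (leq_addr _ _))).
Qed.

(** The trace of Z_m on V gains at least one dimension per step until it fills
V, and at least two at the first step: a first trace of dimension at most 1
would absorb (V :&: Z_2)L, which then vanishes by [prodv_dim_le1]. *)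
Lemma ideal_sub_upper_dim V :
  ideal V -> (1 < \dim V)%N -> (V <= Z (\dim V).-1)%VS.
Proof.
move=> VI dV.
have grow m : ~~ (V <= Z m)%VS -> (\dim (V :&: Z m) < \dim (V :&: Z m.+1))%N.
  move=> VZ; rewrite ltnNge; apply: contra VZ => dVZ.
  apply: ideal_sub_upper => //; apply: subv_trans (capvSr V (Z m)).
  have: (V :&: Z m <= V :&: Z m.+1)%VS by rewrite capvS // upper_centralSS.
  case/dimv_leqif_sup => _ <-.
  by rewrite eqn_leq dVZ dimvS // capvS // upper_centralSS.
have base : (V <= Z 1)%VS \/ (1 < \dim (V :&: Z 1))%N.
  have [d1|] := leqP (\dim (V :&: Z 1)) 1; last by right.
  left; apply: ideal_sub_upper => //; rewrite sub_upper_centralS.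
  suff V2 : (prod (V :&: Z 2) fullv <= V :&: Z 1)%VS.
    by rewrite (prodv_dim_le1 V2 d1) subvv.
  apply/saa_prodvP => v y; rewrite !memv_cap.
  move=> /andP[vV /mem_upper_centralP vZ] _.
  by rewrite vZ andbT; move/saa_idealP: VI; apply.
have dVZ m : (V <= Z m.+1)%VS \/ (m.+1 < \dim (V :&: Z m.+1))%N.
  elim: m => [|m [VZ|dVZ]] //.
    by left; apply: subv_trans VZ (upper_centralSS _).
  have [VZ|/grow VZ] := boolP (V <= Z m.+1)%VS; last by right; lia.
  by left; apply: subv_trans VZ (upper_centralSS _).
have [k dk] : exists k, \dim V = k.+2 by exists (\dim V).-2; lia.
rewrite dk /=; have [//|] := dVZ k.
move=> dk2; apply: subv_trans (capvSr V (Z k.+1)).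
by have /dimv_leqif_sup[dle <-] := capvSl V (Z k.+1); lia.
Qed.

(** Nakayama's argument: otherwise V = U + VL, and iterating this equation gives
V <= U + L^m for all m, so V <= U. *)
Lemma ideal_cover U V :
  ideal U -> ideal V -> (U <= V)%VS -> (\dim V <= (\dim U).+1)%N ->
  (prod V fullv <= U)%VS.
Proof.
move=> UI VI sUV dV.
have sUW : (U <= U + prod V fullv)%VS by exact: addvSl.
have sWV : (U + prod V fullv <= V)%VS by rewrite subv_add sUV.
have [WU|] := leqP (\dim (U + prod V fullv)) (\dim U).
  have /eqP-> : U == (U + prod V fullv)%VS by rewrite eqEdim sUW.
  exact: addvSr.
move=> dW; have WV : (U + prod V fullv)%VS = V.
  by apply/eqP; rewrite eqEdim sWV; lia.
have VU m : (V <= U + lower m.+1)%VS.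
  elim: m => [|m IHm]; first by rewrite addvf subvf.
  rewrite -{1}WV subv_add addvSl; apply/saa_prodvP => v y.
  move/(subvP IHm) => /memv_addP[u uU [w wL ->]] _.
  rewrite linearDl memv_add //; first by move/saa_idealP: UI => ->.
  by rewrite lower_centralSS memv_saa_mul ?memvf.
have /eqP L0 : (lower c.+1 == 0)%VS by rewrite lower_eq0.
by apply: subv_trans VI _; rewrite -[U]addv0 -L0 VU.
Qed.

(** The complement of U annihilates itself, which by duality is the claim.
First N annihilates it, since NL <= U makes (uv, y) = - (uy, v) vanish for u in
N and v in [perp U]; and [perp U] is N plus a single line, on which the product
is alternating. *)
Lemma prodv_perp_lagrangian_hyperplane U N :
  ideal U -> ideal N -> perp N = N -> (U <= N)%VS ->
  (\dim N <= (\dim U).+1)%N -> (prod (perp U) fullv <= U)%VS.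
Proof.
move=> UI NI pN sUN dN; have /saa_prodvP NU := ideal_cover UI NI sUN dN.
have sNpU : (N <= perp U)%VS by rewrite -pN perpS.
have [|b pUb] := add_line_of_codim1 sNpU.
  by have := dim_perp U; have := dim_perp N; rewrite pN; lia.
have NpU u v : u \in N -> v \in perp U -> mul u v = 0.
  move=> uN /mem_orthovP vU; apply: saa_formv0P => y.
  rewrite saa_form_mul_swap.
  by rewrite (saa_form_eq0C (vU _ (NU _ _ uN (memvf y)))) oppr0.
have bU : b \in perp U by rewrite pUb memvE addvSr.
have bpU v : v \in perp U -> mul b v = 0.
  rewrite {1}pUb => /memv_addP[u uN [w /vlineP[k ->] ->]].
  rewrite linearDr linearZr_LR /= saa_mulvv saa_mulN NpU //.
  by rewrite oppr0 scaler0 addr0.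
have pUpU u v : u \in perp U -> v \in perp U -> mul u v = 0.
  rewrite {1}pUb => /memv_addP[w wN [l /vlineP[k ->] ->]] vU.
  by rewrite linearDl linearZl_LR /= NpU // bpU // scaler0 addr0.
rewrite -[X in (_ <= X)%VS]perpK; apply/saa_prodvP => u y uU _.
apply/mem_orthovP => v vU.
by rewrite saa_form_mul_swap pUpU // linear0l oppr0.
Qed.

End Nilpotent.

(** * Maximal class *)

Section MaximalClass.

Variable n : nat.
Hypothesis classA : saa_class A (2 * n - 3).

Lemma upper_top : (fullv <= Z (2 * n - 3))%VS.
Proof. by case: classA => /eqP; rewrite lower_eq0. Qed.

Lemma upper_proper m : (m < 2 * n - 3)%N -> ~~ (fullv <= Z m)%VS.
Proof.
case: classA => _ minc ltm; apply/negP; rewrite -lower_eq0 => /eqP/minc.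
by lia.
Qed.

Lemma dim_upper_ltS m : (m < 2 * n - 3)%N -> (\dim (Z m) < \dim (Z m.+1))%N.
Proof.
move=> ltm; rewrite (ltn_leqif (dimv_leqif_sup (upper_centralSS m))).
apply: contra (upper_proper ltm) => Zm.
by apply: (ideal_sub_upper upper_top (subvf _)); rewrite capfv.
Qed.

Lemma dim_upper_lt m i :
  (m + i <= 2 * n - 3)%N -> (\dim (Z m) + i <= \dim (Z (m + i)))%N.
Proof.
elim: i => [|i IHi] lemi; first by rewrite !addn0.
have := IHi (ltac:(lia)); have := @dim_upper_ltS (m + i) (ltac:(lia)).
by rewrite !addnS; lia.
Qed.

Variable I : nat -> {vspace L}.
Hypotheses (dL : \dim {: L} = (2 * n)%N) (chainI : isotropic_chain A n I).

Lemma chain_dim j : (j <= n)%N -> \dim (I j) = j.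
Proof.
case: chainI => I0 _ _ dI; case: j => [|j] jn; first by rewrite I0 dimv0.
exact: dI.
Qed.

Lemma chain_ideal j : (j <= n)%N -> ideal (I j).
Proof. by case: chainI => _ _ + _ => /[apply] -[]. Qed.

Lemma chain_perp_dim j : (j <= n)%N -> \dim (perp (I j)) = (2 * n - j)%N.
Proof. by move=> jn; have := dim_perp (I j); rewrite dL chain_dim //; lia. Qed.

Lemma chain_top_lagrangian : perp (I n) = I n.
Proof.
apply/esym/eqP; rewrite eqEdim chain_perp_dim // chain_dim //.
apply/andP; split; last by lia.
by case: chainI => _ _ /(_ n (leqnn n))[_ iso] _; apply/orthovP.
Qed.

Hypothesis n4 : (4 <= n)%N.

(** The series climbs strictly from Z_m to Z_(2n-4), which is proper and so has
codimension at least 2 by [upper_codim1_full]. *)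
Lemma dim_upper_le m : (m <= 2 * n - 4)%N -> (\dim (Z m) <= m.+2)%N.
Proof.
move=> lem; have := @dim_upper_lt m (2 * n - 4 - m) (ltac:(lia)).
rewrite subnKC //; suff: (\dim (Z (2 * n - 4)) <= 2 * n - 2)%N by lia.
have : ~~ (fullv <= Z (2 * n - 4))%VS by apply: upper_proper; lia.
have -> : (2 * n - 4 = (2 * n - 5).+1)%N by lia.
rewrite leqNgt; apply: contra => dZ; apply: upper_codim1_full.
by rewrite dL; lia.
Qed.

Lemma chain_sub_upper j : (2 <= j <= n)%N -> (I j <= Z j.-1)%VS.
Proof.
move=> /andP[j2 jn]; have := ideal_sub_upper_dim upper_top (chain_ideal jn).
by rewrite chain_dim //; apply.
Qed.

(** One inclusion is [prodv_perp_lagrangian_hyperplane] for I_(n-1) in I_n; the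
other follows because both sides have dimension n+1. *)
Lemma upper_middle : Z n.-1 = perp (I n.-1).
Proof.
apply/esym/eqP; rewrite eqEdim chain_perp_dim; last lia.
apply/andP; split; last by have := @dim_upper_le n.-1 (ltac:(lia)); lia.
have -> : Z n.-1 = Z n.-2.+1 by congr (Z _); lia.
rewrite sub_upper_centralS.
have sI : (I n.-1 <= Z n.-2)%VS by apply: chain_sub_upper; lia.
apply: subv_trans sI.
apply: (prodv_perp_lagrangian_hyperplane upper_top (N := I n)).
- by apply: chain_ideal; lia.
- exact: chain_ideal.
- exact: chain_top_lagrangian.
- case: chainI => _ /(_ n.-1 (ltac:(lia)))[+ _] _ _.
  by rewrite (ltn_predK n4).
- by rewrite !chain_dim //; lia.
Qed.

(** The alternative is dimension n. Then Z_(n-2) is I_(n-1) plus a line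
orthogonal to I_(n-1), hence Lagrangian, and duality puts L^(n-1) inside
Z_(n-2), which makes the class smaller than 2n-3. *)
Lemma dim_upper_middle : \dim (Z n.-2) = n.-1.
Proof.
have sI : (I n.-1 <= Z n.-2)%VS by apply: chain_sub_upper; lia.
have dI : \dim (I n.-1) = n.-1 by rewrite chain_dim //; lia.
have sZ : (Z n.-2 <= perp (I n.-1))%VS.
  by rewrite -upper_middle upper_central_mono //; lia.
apply/eqP; rewrite eqn_leq -{3}dI dimvS // andbT leqNgt; apply/negP => dZ.
have dZn : \dim (Z n.-2) = n by have := @dim_upper_le n.-2 (ltac:(lia)); lia.
have [|c Zc] := add_line_of_codim1 sI; first by lia.
have cI : c \in perp (I n.-1) by apply: (subvP sZ); rewrite Zc memvE addvSr.
have isoI : (I n.-1 <= perp (I n.-1))%VS by apply: subv_trans sZ.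
have isoZ : (Z n.-2 <= perp (Z n.-2))%VS.
  rewrite Zc orthoDv !orthovD isoI orthov11 saa_formvv eqxx -!memvE cI !andbT.
  by rewrite orthov_sym -memvE.
have pZ : perp (Z n.-2) = Z n.-2.
  apply/esym/eqP; rewrite eqEdim isoZ /=.
  by have := dim_perp (Z n.-2); rewrite dL dZn; lia.
have := lower_sub_perp_upper n.-2; rewrite pZ lower_sub_upper.
by apply/negP/upper_proper; lia.
Qed.

Lemma dim_upper_low m : (1 <= m <= n - 2)%N -> (\dim (Z m) <= m.+1)%N.
Proof.
move=> /andP[m1 mn]; have := @dim_upper_lt m (n - 2 - m) (ltac:(lia)).
have -> : (m + (n - 2 - m) = n.-2)%N by lia.
by rewrite dim_upper_middle; lia.
Qed.

Lemma chain_eq_upper j : (2 <= j <= n.-1)%N -> I j = Z j.-1.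
Proof.
move=> jn; apply/eqP; rewrite eqEdim chain_sub_upper; last lia.
rewrite chain_dim; last lia.
by have := @dim_upper_low j.-1 (ltac:(lia)); lia.
Qed.

(** Downward induction on j from [upper_middle]: since I_j and I_(j+1) are
consecutive terms of the upper central series, I_(j+1) L <= I_j, and duality
gives P(I_j) L <= P(I_(j+1)). *)
Lemma chain_perp_eq_upper j :
  (2 <= j <= n.-1)%N -> perp (I j) = Z (2 * n - 2 - j).
Proof.
move=> jn; apply/eqP; rewrite eqEdim chain_perp_dim; last lia.
have dZ := @dim_upper_le (2 * n - 2 - j) (ltac:(lia)).
apply/andP; split; last lia.
have [i jE] : exists i, j = (n.-1 - i)%N by exists (n.-1 - j)%N; lia.
elim: i j jE jn {dZ} => [|i IHi] j jE jn.
  have -> : j = n.-1 by lia.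
  by rewrite -upper_middle upper_central_mono //; lia.
have -> : (2 * n - 2 - j = (2 * n - 2 - j.+1).+1)%N by lia.
rewrite sub_upper_centralS; apply: subv_trans (IHi j.+1 _ _); [|lia|lia].
apply: prodv_perp; rewrite !chain_eq_upper; [|lia|lia].
by rewrite -sub_upper_centralS -pred_Sn prednK //; lia.
Qed.

Lemma ideal_unique_low j V :
  (2 <= j <= n.-1)%N -> ideal V -> \dim V = j -> V = I j.
Proof.
move=> jn VI dV; rewrite chain_eq_upper //.
have := ideal_sub_upper_dim upper_top VI; rewrite dV => sVZ.
apply/eqP; rewrite eqEdim sVZ ?dV /=; last lia.
by have := @dim_upper_low j.-1 (ltac:(lia)); lia.
Qed.

Lemma ideal_unique_high j V :
  (2 <= j <= n.-1)%N -> ideal V -> \dim V = (2 * n - j)%N -> V = perp (I j).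
Proof.
move=> jn VI dV; rewrite -(ideal_unique_low jn (perp_ideal VI)) ?perpK //.
by have := dim_perp V; rewrite dL dV; lia.
Qed.

End MaximalClass.

End SAATheory.

Lemma nth_maximal_class_dims n m : (4 <= n)%N -> (m <= 2 * n - 3)%N ->
  nth 0%N (maximal_class_dims n) m =
    if m == 0%N then 0%N else
    if (m <= n - 2)%N then m.+1 else
    if (m <= 2 * n - 4)%N then m.+2 else (2 * n)%N.
Proof.
move=> n4; case: m => [|m] lem //=.
rewrite !nth_cat !size_iota; have [lt1|le1] := ltnP m (n - 2).
  by rewrite nth_iota //; lia.
have [lt2|le2] := ltnP (m - (n - 2)) (n - 2).
  by rewrite nth_iota // ifT; lia.
have -> : (m - (n - 2) - (n - 2) = 0)%N by lia.
by rewrite ifF //; lia.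
Qed.

Theorem theorem3p23 (F : fieldType) (L : vectType F) (A : saa L) (n : nat)
    (I : nat -> {vspace L}) :
  \dim (fullv : {vspace L}) = (2 * n)%N ->
  (8 <= 2 * n)%N ->
  saa_nilpotent A ->
  isotropic_chain A n I ->
  saa_class A (2 * n - 3) ->
  [/\ forall j, (2 <= j <= n - 1)%N -> I j = upper_central A (j - 1),
      forall j, (2 <= j <= n - 1)%N ->
        saa_perp A (I j) = upper_central A (2 * n - 2 - j) &
      forall m, (m <= 2 * n - 3)%N ->
        unique_ideal_of_dim A (nth 0%N (maximal_class_dims n) m)
          (upper_central A m)].
Proof.
move=> dL n8 _ chainI classA; have n4 : 4 <= n by lia.
have IZ j : 2 <= j <= n - 1 -> I j = upper_central A (j - 1).
  by rewrite !subn1; apply: chain_eq_upper.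
have pIZ j : 2 <= j <= n - 1 ->
    saa_perp A (I j) = upper_central A (2 * n - 2 - j).
  by rewrite subn1; apply: chain_perp_eq_upper.
split=> // m lem; rewrite nth_maximal_class_dims //.
suff [dZ uZ] : \dim (upper_central A m) =
    (if m == 0 then 0 else if m <= n - 2 then m.+1 else
     if m <= 2 * n - 4 then m.+2 else 2 * n) /\
    forall V, saa_ideal A V -> \dim V = \dim (upper_central A m) ->
      V = upper_central A m.
  by split; rewrite -?dZ //; apply: upper_central_ideal.
have [->|m0] := eqVneq m 0.
  by rewrite /= dimv0; split=> // V _ /eqP; rewrite dimv_eq0 => /eqP.
have [mn|nm] := leqP m (n - 2).
  have jn : 2 <= m.+1 <= n.-1 by lia.
  have -> : upper_central A m = I m.+1.
    by rewrite IZ; [congr upper_central|]; lia.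
  have dI : \dim (I m.+1) = m.+1 by apply: (chain_dim chainI); lia.
  by split=> // V VI; rewrite dI;
    exact: (ideal_unique_low classA dL chainI n4 jn VI).
have [mn2|n2m] := leqP m (2 * n - 4).
  have [j jE] : exists j, j = 2 * n - 2 - m by exists (2 * n - 2 - m).
  have jn : 2 <= j <= n.-1 by lia.
  have -> : upper_central A m = saa_perp A (I j).
    by rewrite pIZ; [congr upper_central|]; lia.
  have dI : \dim (saa_perp A (I j)) = 2 * n - j.
    by apply: (chain_perp_dim dL chainI); lia.
  split=> [|V VI]; first by lia.
  by rewrite dI; exact: (ideal_unique_high classA dL chainI n4 jn VI).
have mE : m = 2 * n - 3 by lia.
have -> : upper_central A m = fullv.
  by apply/eqP; rewrite eqEsubv subvf mE upper_top.
by split=> // V _ dV; apply/eqP; rewrite eqEdim subvf dV leqnn.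
Qed.
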